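(* The local objects of the factorisation system $(Int,IntClo)$ on $CRings$ (viewed as $(IntClo^o,Int^o)$ on $CRings^o$) are the integrally closed domains whose fraction field is algebraically closed.
   Context: $CRings$ is the category of commutative unital rings. For a ring map $A\to B$, an element $b\in B$ is integral over $A$ if it is a root of a monic polynomial with coefficients in $A$. $Int$ is the class of integral maps (ring maps $A\to B$, not necessarily injective, such that every element of $B$ is integral over $A$). $IntClo$ is the class of integrally closed monomorphisms (injective maps $A\subset B$ such that every element of $B$ integral over $A$ is in $A$). $(Int,IntClo)$ is a unique factorisation system on $CRings$ with left class $Int$. A ring $K$ is a point of this system if $K\neq0$ and every finitely presented integral map $K\to B$ with $B\ne0$ admits a retraction. A point covering family of $A$ is a family $\{A\to A_i\}$ of finitely presented integral maps such that every ring map $A\to K$ with $K$ a point factors through some $A\to A_i$. $A$ is a local object if for every point covering family $\{A\to A_i\}$ of $A$, at least one $A\to A_i$ admits a retraction. An integrally closed domain is an integral domain that is integrally closed in its fraction field. *)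

(* Defs.v *)
From HB Require Import structures.
From mathcomp Require Import all_boot all_order all_algebra.
From mathcomp.multinomials Require Import mpoly.

Set Implicit Arguments.
Unset Strict Implicit.
Unset Printing Implicit Defensive.

Import GRing.Theory.
Local Open Scope ring_scope.

(* Commutative unital rings are taken as [comPzRingType], so that the zero    *)
(* ring is included.                                                          *)

(* The monic polynomial is 'X^n + \sum_(i < n) c_i 'X^i, spelled out because  *)
(* [integralOver] only applies to nonzero rings.                              *)
Definition integral_over (A B : comPzRingType) (f : {rmorphism A -> B}) (b : B) :
    Prop :=
  exists (n : nat) (c : 'I_n -> A),
    b ^+ n + \sum_(i < n) f (c i) * b ^+ i = 0.

Definition Int (A B : comPzRingType) (f : {rmorphism A -> B}) : Prop :=
  forall b : B, integral_over f b.

Definition IntClo (A B : comPzRingType) (f : {rmorphism A -> B}) : Prop :=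
  injective f /\ forall b : B, integral_over f b -> exists a : A, f a = b.

Definition nz_ring (A : comPzRingType) (A_neq0 : 1 != 0 :> A) :
    comNzRingType :=
  HB.pack (GRing.ComPzRing.sort A)
    (GRing.PzSemiRing_isNonZero.Build (GRing.ComPzRing.sort A) A_neq0).

(* B is isomorphic, over A, to the quotient of a polynomial ring              *)
(* A[X_1, ..., X_n] by a finitely generated ideal. The type {mpoly A[n]}      *)
(* requires A to be nonzero; nothing is required when A = 0, since then B = 0 *)
(* and f is an isomorphism.                                                   *)
Definition finitely_presented (A B : comPzRingType) (f : {rmorphism A -> B}) :
    Prop :=
  forall A_neq0 : 1 != 0 :> A,
  exists (n : nat) (phi : {rmorphism {mpoly (nz_ring A_neq0)[n]} -> B}),
    [/\ forall a : A, phi (@mpolyC n (nz_ring A_neq0) a) = f a,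
        forall b : B, exists p, phi p = b
      & exists (m : nat) (r : 'I_m -> {mpoly (nz_ring A_neq0)[n]}),
          forall p, phi p = 0 <->
            exists q : 'I_m -> {mpoly (nz_ring A_neq0)[n]},
              p = \sum_(j < m) q j * r j].

Definition has_retraction (A B : comPzRingType) (f : {rmorphism A -> B}) :
    Prop :=
  exists r : {rmorphism B -> A}, forall a : A, r (f a) = a.

Definition is_point (K : comPzRingType) : Prop :=
  1 <> 0 :> K /\
  forall (B : comPzRingType) (f : {rmorphism K -> B}),
    finitely_presented f -> Int f -> 1 <> 0 :> B -> has_retraction f.

(* The index type is arbitrary; in particular the family may be empty.        *)
Definition point_covering (A : comPzRingType) (I : Type)
    (A_ : I -> comPzRingType) (f : forall i, {rmorphism A -> A_ i}) : Prop :=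
  (forall i, finitely_presented (f i) /\ Int (f i)) /\
  forall (K : comPzRingType) (g : {rmorphism A -> K}), is_point K ->
    exists (i : I) (h : {rmorphism A_ i -> K}), forall a : A, h (f i a) = g a.

Definition local_object (A : comPzRingType) : Prop :=
  forall (I : Type) (A_ : I -> comPzRingType)
    (f : forall i, {rmorphism A -> A_ i}),
    point_covering f -> exists i : I, has_retraction (f i).

Definition integrally_closed_domain (D : idomainType) : Prop :=
  IntClo (@tofrac D : {rmorphism D -> {fraction D}}).

Definition algebraically_closed (F : fieldType) : Prop :=
  GRing.closed_field_axiom F.

(* Main.v *)
Require Import Defs.
From HB Require Import structures.
From mathcomp Require Import all_boot all_order all_algebra.
From mathcomp.multinomials Require Import mpoly.
From mathcomp Require Import boolp classical_sets.

Set Implicit Arguments.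
Unset Strict Implicit.
Unset Printing Implicit Defensive.

Import GRing.Theory.
Local Open Scope ring_scope.

(** The points of the system are the algebraically closed fields.  If [K] is a
    point and [a] is not a unit, then [K -> K/(a)] is a finitely presented
    integral map to a nonzero ring, and a retraction of it forces [a = 0]; so
    every nonzero element of [K] is a unit.  If [p] is monic and not constant,
    then a retraction of [K -> K[X]/(p)] sends the class of [X] to a root of
    [p].  Conversely, let [F] be an algebraically closed field and [F -> B] an
    integral map with [B] nonzero.  Some morphism [s] maps [B] to a domain [Q],
    and every element of [Q] integral over [F] already lies in [F], because its
    monic equation splits over [F]; so [s] corestricts to a retraction.

    Let [A] be a local object.  It is nonzero, as otherwise the empty family
    would be a point covering.  It is a domain: if [a b = 0], then
    [{A -> A/(a), A -> A/(b)}] is a point covering because points are domains,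
    and a retraction of one of the two maps gives [a = 0] or [b = 0].  A
    nonconstant monic polynomial [p] over [A] has a root in [A]: the single map
    [A -> A[X]/(p)] is a point covering because [p] has a root in every point,
    and a retraction of it yields a root in [A].  These roots alone give the
    other two properties: monic polynomials over [A] split in [A], so the
    elements of the fraction field integral over [A] lie in [A]; and a monic
    polynomial over the fraction field becomes one over [A] after its roots are
    multiplied by a common denominator of its coefficients.

    Conversely, let [A] be an integrally closed domain whose fraction field [F]
    is algebraically closed.  Then [F] is a point, so [A -> F] factors through
    some member [A -> A_i] of a given point covering.  The image of [A_i] in
    [F] is integral over [A], hence equal to [A], and [A_i -> F] corestricts to
    a retraction [A_i -> A].

    The carriers of the argument are [integral_in_range] (the splitting
    argument, used for both closed fields and integrally closed domains),
    [kill_element] and [adjoin_root] (the two coverings), [closed_field_point],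
    [point_unit] and [point_monic_roots] (the points). *)

(** * Building ring morphisms *)

Lemma rmorphism_of_laws (A B : pzRingType) (r : B -> A) :
  r 1 = 1 -> {morph r : x y / x - y} -> {morph r : x y / x * y} ->
  exists h : {rmorphism B -> A}, h =1 r.
Proof.
move=> r1 rB rM.
pose zr := GRing.isZmodMorphism.Build B A r rB.
pose mr := GRing.isMonoidMorphism.Build B A r (r1, rM).
pose h : {rmorphism B -> A} := HB.pack r zr mr.
by exists h.
Qed.

(** Every retraction constructed below arises in this way, from a map into a
    larger ring whose values are found to lie in the smaller one. *)
Lemma factor_through_injection (A B Q : comPzRingType)
    (g : {rmorphism A -> Q}) (s : {rmorphism B -> Q}) :
  injective g -> (forall b, exists a, g a = s b) ->
  exists r : {rmorphism B -> A}, forall b, g (r b) = s b.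
Proof.
move=> g_inj /choice[r rP].
have [||| h hE] := @rmorphism_of_laws A B r.
- by apply: g_inj; rewrite rP !rmorph1.
- by move=> x y; apply: g_inj; rewrite rmorphB !rP rmorphB.
- by move=> x y; apply: g_inj; rewrite rmorphM !rP rmorphM.
by exists h => b; rewrite hE.
Qed.

Lemma factor_through_surjection (A B K : comPzRingType)
    (s : {rmorphism A -> B}) (g : {rmorphism A -> K}) :
  (forall b, exists a, s a = b) -> (forall a, s a = 0 -> g a = 0) ->
  exists h : {rmorphism B -> K}, forall a, h (s a) = g a.
Proof.
move=> /choice[t tK] ker_s.
have gt a : g (t (s a)) = g a.
  by apply/subr0_eq; rewrite -rmorphB; apply: ker_s; rewrite rmorphB tK subrr.
have [||| h hE] := @rmorphism_of_laws K B (g \o t).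
- by rewrite /= -(rmorph1 s) gt rmorph1.
- by move=> x y; rewrite /= -{1}(tK x) -{1}(tK y) -rmorphB gt rmorphB.
- by move=> x y; rewrite /= -{1}(tK x) -{1}(tK y) -rmorphM gt rmorphM.
by exists h => a; rewrite hE /= gt.
Qed.

(** * Quotients, and maps to domains *)

Lemma quotient_by_ideal (R : comNzRingType) (I : R -> Prop) :
  I 0 -> ~ I 1 -> (forall a u v, I u -> I v -> I (a * u + v)) ->
  exists (Q : comNzRingType) (s : {rmorphism R -> Q}),
    (forall b, exists a, s a = b) /\ (forall a, s a = 0 <-> I a).
Proof.
move=> I0 I1 Iclosed; pose J : R -> bool := fun a => `[< I a >].
have J_ideal : idealr_closed J.
  split; first exact/asboolP.
    by apply/asboolPn.
  by move=> a u v /asboolP Iu /asboolP Iv; apply/asboolP/Iclosed.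
pose JI : idealr R := HB.pack J (isIdealr.Build R J J_ideal).
exists (Quotient.quot JI), \pi_(Quotient.quot JI)%qT; split=> [b|a].
  by exists (repr b); apply: (reprK b).
rewrite -(rmorph0 \pi_(Quotient.quot JI)%qT); split=> [/eqP|Ia].
  by rewrite -Quotient.idealrBE subr0 => /asboolP.
by apply/eqP; rewrite -Quotient.idealrBE subr0; apply/asboolP.
Qed.

(** The quotient by an ideal maximal among those that miss 1.  Zorn's lemma is
    applied to the sets closed under [a * u + v] and missing 1; not asking
    that they contain 0 lets the empty chain have an upper bound, and the
    maximal one is not empty since it could be enlarged to the zero ideal. *)
Lemma maps_to_domain (B : comNzRingType) :
  exists (Q : comNzRingType) (s : {rmorphism B -> Q}),
    forall u v : Q, u * v = 0 -> u = 0 \/ v = 0.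
Proof.
pose P (S : set B) := (forall a u v, S u -> S v -> S (a * u + v)) /\ ~ S 1.
have [|M [[Mclosed M1] Mmax]] := @Zorn_bigcup B P.
  move=> F FP Ftot; split=> [a u v [X FX Xu] [Y FY Yv]|[X FX]]; last first.
    by have [] := FP X FX.
  have [XY|YX] := Ftot X Y FX FY.
    by exists Y => //; apply: (FP Y FY).1 => //; apply: XY.
  by exists X => //; apply: (FP X FX).1 => //; apply: YX.
have M0 : M 0.
  apply: contrapT => M0.
  have Mempty u : ~ M u.
    move=> Mu; apply: M0; rewrite -(subrr u) -mulN1r addrC.
    exact: Mclosed.
  apply: (Mmax [set 0]%classic).
    by split=> [u /Mempty//|/(_ 0 erefl)].
  by split=> [a u v -> ->|/eqP]; rewrite ?oner_eq0 // mulr0 addr0.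
have [Q [s [s_surj s_ker]]] := quotient_by_ideal M0 M1 Mclosed.
exists Q, s => x y; have [u <-] := s_surj x; have [v <-] := s_surj y.
rewrite -rmorphM !s_ker => Muv; have [Mu|Mu] := EM (M u); [by left|right].
(* [N] is the ideal generated by [M] and [u]; as it is larger than [M], it
   contains 1. *)
pose N : set B := fun w => exists b, M (w - u * b).
have [b Mb] : N 1.
  apply: contrapT => N1; apply: (Mmax N).
    split=> [w Mw|NM]; first by exists 0; rewrite mulr0 subr0.
    by apply/Mu/NM; exists 1; rewrite mulr1 subrr.
  split=> // a w1 w2 [b1 M1'] [b2 M2']; exists (a * b1 + b2).
  have -> : a * w1 + w2 - u * (a * b1 + b2) = a * (w1 - u * b1) + (w2 - u * b2).
    by rewrite mulrDr opprD mulrBr mulrCA addrACA.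
  exact: Mclosed.
(* With [m := 1 - u b] in [M], [v = v m + b (u v)]. *)
have -> : v = v * (1 - u * b) + (b * (u * v) + 0).
  by rewrite addr0 mulrBr mulr1 (mulrC v) (mulrC u) mulrA subrK.
by apply: (Mclosed) => //; apply: Mclosed.
Qed.

(** * Integral elements and roots of monic polynomials *)

(** Gives access to the closure of integral elements under ring operations. *)
Lemma integral_overP (R B : comNzRingType) (f : {rmorphism R -> B}) (b : B) :
  integral_over f b <-> integralOver f b.
Proof.
split=> [[n [c bc0]]|[p p_monic pb0]].
  exists ('X^n + \sum_(i < n) c i *: 'X^i).
    rewrite monicE lead_coefDl ?lead_coefXn // size_polyXn ltnS.
    apply: (leq_trans (size_sum _ _ _)); apply/bigmax_leqP => i _.
    by rewrite (leq_trans (size_scale_leq _ _)) ?size_polyXn.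
  rewrite /root rmorphD rmorph_sum /= map_polyXn hornerD hornerXn -bc0.
  rewrite horner_sum; apply/eqP; congr (_ + _); apply: eq_bigr => i _.
  by rewrite /= map_polyZ map_polyXn hornerZ hornerXn.
have p_gt0 : (0 < size p)%N by rewrite size_poly_gt0 monic_neq0.
exists (size p).-1, (fun i => p`_i).
move: pb0; rewrite /root horner_coef size_map_poly_id0; last first.
  by rewrite (monicP p_monic) rmorph1 oner_neq0.
rewrite -(prednK p_gt0) big_ord_recr /= coef_map -lead_coefE (monicP p_monic).
rewrite /= rmorph1 mul1r addrC => /eqP {2}<-; congr (_ + _).
by apply: eq_bigr => i _; rewrite coef_map.
Qed.

Definition has_monic_roots (R : nzRingType) :=
  forall p : {poly R}, p \is monic -> (1 < size p)%N -> exists x, root p x.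

Lemma root_of_retraction (R B : comNzRingType) (f : {rmorphism R -> B})
    (s : {rmorphism B -> R}) (p : {poly R}) (x : B) :
  cancel f s -> root (map_poly f p) x -> root p (s x).
Proof.
move=> sK /(rmorph_root s); rewrite -map_poly_comp.
by rewrite map_poly_id // => c _ /=; rewrite sK.
Qed.

Lemma monic_roots_transfer (R S : comNzRingType) (e : {rmorphism R -> S})
    (e' : {rmorphism S -> R}) :
  cancel e' e -> has_monic_roots R -> has_monic_roots S.
Proof.
move=> e'K R_roots p p_monic p_gt1.
have [||x px0] := R_roots (map_poly e' p).
- exact: monic_map.
- by rewrite size_map_poly_id0 // (monicP p_monic) rmorph1 oner_neq0.
by exists (e x); apply: root_of_retraction e'K _; rewrite px0.
Qed.

(** A monic equation of [y] over [R] splits into linear factors over [R], so in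
    the domain [K] one of the factors vanishes at [y]. *)
Lemma integral_in_range (R K : comNzRingType) (g : {rmorphism R -> K}) (y : K) :
  (forall u v : K, u * v = 0 -> u = 0 \/ v = 0) -> has_monic_roots R ->
  integral_over g y -> exists a, g a = y.
Proof.
move=> K_dom R_roots /integral_overP[p p_monic py0].
elim: {p}(size p) {-2}p (leqnn (size p)) p_monic py0 => [|n IHn] p.
  by rewrite leqn0 size_poly_eq0 => /eqP-> /monic_neq0; rewrite eqxx.
move=> p_le p_monic py0; case: (leqP (size p) 1) => [/size1_polyC p1|p_gt1].
  move: p_monic py0; rewrite p1 monicE lead_coefC => /eqP->.
  by rewrite map_polyC rootC /= rmorph1 oner_eq0.
have [x /factor_theorem[q p_eq]] := R_roots p p_monic p_gt1.
have q_monic : q \is monic by rewrite -(monicMr _ (monicXsubC x)) -p_eq.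
move: py0; rewrite p_eq rmorphM /= map_polyXsubC /root hornerM hornerXsubC.
move=> /eqP/K_dom[qy0|/subr0_eq]; last by exists x.
apply: (IHn q) => //; last exact/eqP.
rewrite -ltnS (leq_trans _ p_le) // p_eq.
by rewrite size_Mmonic ?monicXsubC ?monic_neq0 // size_XsubC addn2.
Qed.

Lemma closed_field_monic_roots (F : fieldType) :
  algebraically_closed F -> has_monic_roots F.
Proof.
move=> F_closed p p_monic p_gt1.
have [|x xP] := F_closed (size p).-1 (fun i => - p`_i).
  by rewrite -subn1 subn_gt0.
exists x; rewrite /root horner_coef -(ltn_predK p_gt1) big_ord_recr /=.
rewrite -lead_coefE (monicP p_monic) mul1r xP -big_split big1 //= => i _.
by rewrite mulNr subrr.
Qed.

Lemma fraction_clear_denominator (D : idomainType) (y : {fraction D}) :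
  exists a d : D, d != 0 /\ y * tofrac d = tofrac a.
Proof.
elim/quotW: y => x; exists \n_x, \d_x; split; first exact: denom_ratioP.
have tofracE (a : D) : tofrac a = \pi_(FracField.type D)%qT (Ratio a 1).
  by unlock tofrac.
rewrite !tofracE -[LHS]FracField.pi_mul; apply/eqP.
rewrite FracField.equivf_def /FracField.mulf.
by rewrite !numden_Ratio ?mulr1 ?oner_neq0 ?denom_ratioP // mulrC.
Qed.

Lemma fraction_common_denominator (D : idomainType) (n : nat)
    (y : nat -> {fraction D}) :
  exists (a : nat -> D) (d : D), d != 0 /\
    forall i, (i < n)%N -> y i * tofrac d = tofrac (a i).
Proof.
have /choice[a /choice[d ad]] := fun i => fraction_clear_denominator (y i).
exists (fun i => a i * \prod_(j < n | j != i :> nat) d j), (\prod_(j < n) d j).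
split=> [|i lt_in]; first by apply/prodf_neq0 => i _; case: (ad i).
rewrite (bigD1 (Ordinal lt_in)) //= rmorphM mulrA (ad i).2 -rmorphM.
by congr (tofrac (_ * _)); apply: eq_bigl.
Qed.

(** If [d] is a common denominator of the coefficients [y i], then [x] is a root
    of the given equation when [d x] is a root of a monic polynomial over [D]. *)
Lemma monic_roots_fraction_closed (D : idomainType) :
  has_monic_roots D -> algebraically_closed {fraction D}.
Proof.
move=> D_roots n y n_gt0.
have [a [d [d_neq0 ad]]] := fraction_common_denominator n y.
have df_neq0 : tofrac d != 0 by rewrite tofrac_eq0.
(* Multiplying [x ^+ n = \sum_i y_i x ^+ i] by [d ^+ n] turns it into the
   equation [z ^+ n = q.[z]] of [z = d x]. *)
pose q := \sum_(i < n) (a i * d ^+ (n.-1 - i)) *: 'X^i.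
have q_size : (size q <= n)%N.
  apply: (leq_trans (size_sum _ _ _)); apply/bigmax_leqP => i _.
  by rewrite (leq_trans (size_scale_leq _ _)) ?size_polyXn.
have p_monic : 'X^n - q \is monic.
  by rewrite monicE lead_coefDl ?lead_coefXn // size_polyN size_polyXn ltnS.
have [|z] := D_roots _ p_monic.
  by rewrite size_polyDl size_polyXn ?ltnS // size_polyN.
rewrite /root hornerD hornerN hornerXn horner_sum subr_eq0 => /eqP zn.
exists (tofrac z / tofrac d); apply: (mulIf (expf_neq0 n df_neq0)).
rewrite -exprMn divfK // -rmorphXn zn rmorph_sum mulr_suml.
apply: eq_bigr => i _; rewrite hornerZ hornerXn !rmorphM !rmorphXn /= -ad //.
have i_le : (i <= n.-1)%N by rewrite -ltnS prednK.
have -> : tofrac d ^+ n = tofrac d * tofrac d ^+ (n.-1 - i) * tofrac d ^+ i.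
  by rewrite -mulrA -exprD subnK // -exprS prednK.
rewrite -[in LHS](divfK df_neq0 (tofrac z)) exprMn -!mulrA; congr (_ * _).
by rewrite 2!(mulrCA _ ((tofrac z / tofrac d) ^+ i)).
Qed.

(** * Finitely presented algebras *)

(** [B] is presented over [R] by the generators [x i] and the relators [r j]. *)
Definition presentation (R B : comNzRingType) (f : {rmorphism R -> B})
    (n : nat) (x : 'I_n -> B) (m : nat) (r : 'I_m -> {mpoly R[n]}) : Prop :=
  (forall b, exists p, mmap f x p = b) /\
  forall p, mmap f x p = 0 <->
    exists q : 'I_m -> {mpoly R[n]}, p = \sum_(j < m) q j * r j.

Lemma presentation_exists (R : comNzRingType) (n m : nat)
    (r : 'I_m -> {mpoly R[n]}) :
  ~ (exists q : 'I_m -> {mpoly R[n]}, 1 = \sum_(j < m) q j * r j) ->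
  exists (B : comNzRingType) (f : {rmorphism R -> B}) (x : 'I_n -> B),
    presentation f x r.
Proof.
move=> proper.
pose I p := exists q : 'I_m -> {mpoly R[n]}, p = \sum_(j < m) q j * r j.
have [||B [s [s_surj s_ker]]] := @quotient_by_ideal _ I _ proper.
- by exists (fun=> 0); rewrite big1 // => j _; rewrite mul0r.
- move=> a _ _ [q1 ->] [q2 ->]; exists (fun j => a * q1 j + q2 j).
  rewrite mulr_sumr -big_split; apply: eq_bigr => j _ /=.
  by rewrite mulrDl mulrA.
exists B, (s \o @mpolyC n R), (fun i => s 'X_i).
have mmapE p : mmap (s \o @mpolyC n R) (fun i => s 'X_i) p = s p.
  rewrite [in RHS](mpolyE p) rmorph_sum /mmap; apply: eq_bigr => k _ /=.
  rewrite -mul_mpolyC rmorphM; congr (_ * _).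
  rewrite /mmap1 mpolyXE_id rmorph_prod; apply: eq_bigr => i _.
  by rewrite rmorphXn.
by split=> [b|p]; [have [p <-] := s_surj b; exists p | rewrite mmapE].
Qed.

Lemma presentation_rel (R B : comNzRingType) (f : {rmorphism R -> B})
    (n : nat) (x : 'I_n -> B) (m : nat) (r : 'I_m -> {mpoly R[n]}) j :
  presentation f x r -> mmap f x (r j) = 0.
Proof.
move=> [_ ker]; apply/ker; exists (fun i => (i == j)%:R).
rewrite (bigD1 j) //= eqxx mul1r big1 ?addr0 // => i /negPf->.
by rewrite mul0r.
Qed.

Lemma presentation_lift (R B K : comNzRingType) (f : {rmorphism R -> B})
    (n : nat) (x : 'I_n -> B) (m : nat) (r : 'I_m -> {mpoly R[n]})
    (g : {rmorphism R -> K}) (y : 'I_n -> K) :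
  presentation f x r -> (forall j, mmap g y (r j) = 0) ->
  exists h : {rmorphism B -> K}, forall a, h (f a) = g a.
Proof.
move=> [surj ker] yr0.
have [|h hE] := @factor_through_surjection _ _ _ (mmap f x) (mmap g y) surj.
  move=> p /ker[q ->]; rewrite rmorph_sum big1 // => j _.
  by rewrite rmorphM /= yr0 mulr0.
by exists h => a; rewrite -(mmapC x) hE /= mmapC.
Qed.

(** The elements integral over [R] form a subring, so it is enough that the
    generators are integral. *)
Lemma presentation_int (R B : comNzRingType) (f : {rmorphism R -> B})
    (n : nat) (x : 'I_n -> B) (m : nat) (r : 'I_m -> {mpoly R[n]}) :
  presentation f x r -> (forall i, integralOver f (x i)) -> Int f.
Proof.
move=> [surj _] x_int b; apply/integral_overP; have [p <-] := surj b.
apply: big_ind => [||k _]; [exact: integral0 | exact: integral_add |].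
apply: integral_mul; first exact: integral_id.
apply: big_ind => [||i _]; [exact: integral1 | exact: integral_mul |].
elim: (k i) => [|e IHe]; first exact: integral1.
by rewrite exprS; apply: integral_mul.
Qed.

(** Being finitely presented ranges over all proofs of [1 != 0]; these are equal,
    so a presentation over one copy of the nonzero ring suffices. *)
Lemma presentation_fp (A : comPzRingType) (A1 : 1 != 0 :> A)
    (B : comNzRingType) (f : {rmorphism nz_ring A1 -> B})
    (n : nat) (x : 'I_n -> B) (m : nat) (r : 'I_m -> {mpoly (nz_ring A1)[n]}) :
  presentation f x r -> finitely_presented (f : {rmorphism A -> B}).
Proof.
move=> [surj ker] A2; rewrite (bool_irrelevance A2 A1).
exists n, (mmap f x); split=> //; first by move=> a; apply: mmapC.
by exists m, r.
Qed.

(** The algebra is [A/(a)], presented by no generator and the single constant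
    relator [a].  It is nonzero because [a] is not a unit. *)
Lemma kill_element (A : comPzRingType) (A1 : 1 != 0 :> A) (a : A) :
  ~ (exists b, b * a = 1) ->
  exists (B : comNzRingType) (f : {rmorphism A -> B}),
    [/\ finitely_presented f, Int f, f a = 0
      & forall (K : comNzRingType) (g : {rmorphism A -> K}), g a = 0 ->
          exists h : {rmorphism B -> K}, forall c, h (f c) = g c].
Proof.
move=> a_nunit; pose R := nz_ring A1.
pose r (j : 'I_1) : {mpoly R[0]} := (a : R)%:MP.
have [|B [f [x fxr]]] := @presentation_exists R 0 1 r.
  move=> [q]; rewrite big_ord1 => /(congr1 (meval (fun=> 0))).
  rewrite rmorph1 rmorphM /= mevalC => q_eq.
  by apply: a_nunit; exists ((q ord0).@[fun=> 0]).
exists B, (f : {rmorphism A -> B}); split.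
- exact: presentation_fp fxr.
- by apply: presentation_int fxr _; case.
- by have := presentation_rel ord0 fxr; rewrite mmapC.
move=> K g ga0; pose gR : {rmorphism R -> K} := g.
by apply: (presentation_lift (g := gR) (y := fun=> 0) fxr) => j; rewrite mmapC.
Qed.

Lemma mmap_horner (R S : comNzRingType) (g : {rmorphism R -> S}) (y : S)
    (p : {poly R}) :
  mmap g (fun _ : 'I_1 => y) (map_poly (@mpolyC 1 R) p).['X_ord0]
  = (map_poly g p).[y].
Proof.
rewrite -horner_map /= mmapX mmap1U -map_poly_comp.
by congr _.[_]; apply: eq_map_poly => c /=; rewrite mmapC.
Qed.

(** The algebra is [A[X]/(p)], presented by one generator and the relator [p].
    It is nonzero because a nonzero multiple of the monic polynomial [p] has at
    least the degree of [p], so it is not 1. *)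
Lemma adjoin_root (A : comPzRingType) (A1 : 1 != 0 :> A)
    (p : {poly nz_ring A1}) :
  p \is monic -> (1 < size p)%N ->
  exists (B : comNzRingType) (f : {rmorphism nz_ring A1 -> B}) (x : B),
    [/\ finitely_presented (f : {rmorphism A -> B}),
        Int (f : {rmorphism A -> B}), root (map_poly f p) x
      & forall (K : comNzRingType) (g : {rmorphism nz_ring A1 -> K}) (y : K),
          root (map_poly g p) y ->
          exists h : {rmorphism B -> K}, forall c, h (f c) = g c].
Proof.
move=> p_monic p_gt1; set R := nz_ring A1 in p p_monic p_gt1 *.
pose r (j : 'I_1) := (map_poly (@mpolyC 1 R) p).['X_ord0].
have [|B [f [x fxr]]] := @presentation_exists R 1 1 r.
  (* Sending the generator to ['X] turns the relator into [p] itself. *)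
  move=> [q]; rewrite big_ord1 => /(congr1 (mmap polyC (fun=> 'X))).
  rewrite rmorph1 rmorphM /= mmap_horner -/(comp_poly 'X p) comp_polyXr.
  set q' := mmap _ _ _ => q'p; have q'_neq0 : q' != 0.
    by apply: contraNneq (oner_neq0 {poly R}) => q'0; rewrite q'p q'0 mul0r.
  have := congr1 (fun s : {poly R} => size s) q'p.
  rewrite (size_poly1 R) size_Mmonic // => size_eq.
  move: q'_neq0 p_gt1 size_eq; rewrite -size_poly_gt0.
  by case: (size q') (size p) => // l [|[|k]] // _ _; rewrite !addnS.
have x_eq : x = fun=> x ord0 by apply/funext => i; rewrite (ord1 i).
have px0 : root (map_poly f p) (x ord0).
  by have := presentation_rel ord0 fxr; rewrite x_eq mmap_horner /root => ->.
exists B, f, (x ord0); split=> //.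
- exact: presentation_fp fxr.
- by apply: presentation_int fxr _ => i; rewrite (ord1 i); exists p.
move=> K g y /eqP py0; apply: (presentation_lift (y := fun=> y) fxr) => j.
by rewrite mmap_horner.
Qed.

(** * The points are the algebraically closed fields *)

Lemma point_unit (K : comPzRingType) (a : K) :
  is_point K -> a <> 0 -> exists b, b * a = 1.
Proof.
move=> [/eqP K1 K_retr] a_neq0; apply: contrapT => a_nunit.
have [B [f [f_fp f_int fa0 _]]] := kill_element K1 a_nunit.
have [|s sK] := K_retr B f f_fp f_int; first exact/eqP/oner_neq0.
by apply: a_neq0; rewrite -(sK a) fa0 rmorph0.
Qed.

Lemma point_monic_roots (K : comPzRingType) (K1 : 1 != 0 :> K) :
  is_point K -> has_monic_roots (nz_ring K1).
Proof.
move=> [_ K_retr] p p_monic p_gt1.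
have [B [f [x [f_fp f_int px0 _]]]] := adjoin_root p_monic p_gt1.
have [|s sK] := K_retr B f f_fp f_int; first exact/eqP/oner_neq0.
by exists (s x); apply: (@root_of_retraction (nz_ring K1) B f s).
Qed.

Lemma closed_field_point (F : fieldType) : algebraically_closed F -> is_point F.
Proof.
move=> F_closed; split=> [|B f _ f_int /eqP B1]; first exact/eqP/oner_neq0.
have [Q [s Q_dom]] := maps_to_domain (nz_ring B1).
pose g : {rmorphism F -> Q} := s \o (f : {rmorphism F -> nz_ring B1}).
have [b|r rP] := @factor_through_injection F B Q g s (fmorph_inj g).
  apply: (integral_in_range Q_dom (closed_field_monic_roots F_closed)).
  have [n [c bc0]] := f_int b; exists n, c.
  rewrite -[RHS](rmorph0 s) -bc0 rmorphD rmorphXn rmorph_sum; congr (_ + _).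
  by apply: eq_bigr => i _; rewrite /= rmorphM rmorphXn.
by exists r => a; apply: (fmorph_inj g); rewrite rP.
Qed.

(** * Local objects *)

(** Over the zero ring the empty family is a point covering, since the zero ring
    has no map to a nonzero one. *)
Lemma local_neq0 (A : comPzRingType) : local_object A -> 1 != 0 :> A.
Proof.
move=> A_loc; apply/eqP => A1.
pose F (i : void) : comPzRingType := match i with end.
pose f (i : void) : {rmorphism A -> F i} := match i with end.
have [|[]] := A_loc void F f.
split=> [[]|K g [K1 _]]; case: K1.
by rewrite -(rmorph1 g) A1 rmorph0.
Qed.

(** A point [K] is a field, so a map [A -> K] kills [a] or [b] and factors
    through [A/(a)] or [A/(b)]. *)
Lemma local_domain (A : comPzRingType) (a b : A) :
  local_object A -> a * b = 0 -> a = 0 \/ b = 0.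
Proof.
move=> A_loc ab0; have A1 := local_neq0 A_loc.
have [[c ca1]|a_nunit] := EM (exists c, c * a = 1).
  by right; rewrite -(mul1r b) -ca1 -mulrA ab0 mulr0.
have [[c cb1]|b_nunit] := EM (exists c, c * b = 1).
  by left; rewrite -(mul1r a) -cb1 -mulrA (mulrC b) ab0 mulr0.
have [Ba [fa [fa_fp fa_int fa0 fa_lift]]] := kill_element A1 a_nunit.
have [Bb [fb [fb_fp fb_int fb0 fb_lift]]] := kill_element A1 b_nunit.
pose F (i : bool) : comPzRingType := if i then Ba else Bb.
pose f (i : bool) : {rmorphism A -> F i} :=
  match i return {rmorphism A -> F i} with true => fa | false => fb end.
have [|[] [s sK]] := A_loc bool F f; last 2 first.
- by left; rewrite -(sK a) /= fa0 rmorph0.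
- by right; rewrite -(sK b) /= fb0 rmorph0.
split=> [[]//|K g K_pt]; have [/eqP K1 _] := K_pt.
have [ga0|ga_neq0] := EM (g a = 0).
  by exists true; apply: (fa_lift (nz_ring K1)).
have [c cga1] := point_unit K_pt ga_neq0.
exists false; apply: (fb_lift (nz_ring K1)).
by rewrite -(mul1r (g b)) -cga1 -mulrA -rmorphM ab0 rmorph0 mulr0.
Qed.

(** The family consisting of [A -> A[X]/(p)] alone is a point covering, since
    [p] has a root in every point. *)
Lemma local_monic_roots (A : comPzRingType) (A1 : 1 != 0 :> A) :
  local_object A -> has_monic_roots (nz_ring A1).
Proof.
move=> A_loc p p_monic p_gt1.
have [B [f [x [f_fp f_int px0 f_lift]]]] := adjoin_root p_monic p_gt1.
have [|_ [s sK]] := A_loc unit (fun=> B) (fun=> (f : {rmorphism A -> B})).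
  split=> [//|K g K_pt]; have [/eqP K1 _] := K_pt; exists tt.
  pose g' : {rmorphism nz_ring A1 -> nz_ring K1} := g.
  have [||y py0] := @point_monic_roots K K1 K_pt (map_poly g' p).
  - exact: monic_map.
  - by rewrite size_map_poly_id0 // (monicP p_monic) rmorph1 oner_neq0.
  exact: (f_lift _ g' y).
by exists (s x); apply: (@root_of_retraction (nz_ring A1) B f s).
Qed.

Lemma domain_idomain (A : comPzRingType) :
  1 != 0 :> A -> (forall a b : A, a * b = 0 -> a = 0 \/ b = 0) ->
  exists (D : idomainType) (e : {rmorphism A -> D}) (e' : {rmorphism D -> A}),
    cancel e e' /\ cancel e' e.
Proof.
move=> A1 A_dom; pose R := nz_ring A1.
pose u : pred R := fun a => `[< exists b : R, b * a = 1 >].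
have /choice[v vP] (a : R) :
    exists b : R, (u a -> b * a = 1) /\ (~~ u a -> b = a).
  have [[b ba1]|nu] := EM (exists b : R, b * a = 1).
    by exists b; split=> // /asboolPn[]; exists b.
  by exists a; split=> [/asboolP|].
have vl : {in u, left_inverse 1 v *%R} by move=> a /(vP a).1.
have vu (x y : R) : y * x = 1 -> u x by move=> yx; apply/asboolP; exists y.
have v0 : {in [predC u], v =1 id} by move=> a /(vP a).2.
have R_dom (x y : R) : x * y = 0 -> (x == 0) || (y == 0).
  by move=> /A_dom[] ->; rewrite eqxx ?orbT.
pose U : comUnitRingType := HB.pack (GRing.ComNzRing.sort R)
  (GRing.ComNzRing_hasMulInverse.Build R vl vu v0).
pose D : idomainType := HB.pack (GRing.ComNzRing.sort R) U
  (GRing.ComUnitRing_isIntegral.Build U R_dom).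
pose idA : {rmorphism A -> A} := @idfun A.
by exists D, idA, idA.
Qed.

Theorem proposition106 (A : comPzRingType) :
  local_object A <->
  exists (D : idomainType) (e : {rmorphism A -> D}),
    [/\ bijective e,
        integrally_closed_domain D
      & algebraically_closed {fraction D}].
Proof.
split=> [A_loc|[D [e [[e' eK e'K] D_int F_closed]]] I F f [f_int f_cov]].
  have A1 := local_neq0 A_loc.
  have [D [e [e' [eK e'K]]]] :=
    domain_idomain A1 (fun a b => @local_domain A a b A_loc).
  have D_roots : has_monic_roots D.
    apply: (@monic_roots_transfer (nz_ring A1) D e e' e'K).
    exact: local_monic_roots.
  exists D, e; split; first by exists e'.
    split=> [x y /eqP|y]; first by rewrite tofrac_eq => /eqP.
    apply: integral_in_range => // u v /eqP; rewrite mulf_eq0.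
    by case/orP => /eqP; [left | right].
  exact: monic_roots_fraction_closed.
have F_pt := closed_field_point F_closed; have [D_inj D_clo] := D_int.
pose g : {rmorphism A -> {fraction D}} := @tofrac D \o e.
have g_inj : injective g by move=> x y /D_inj/(can_inj eK).
have [i [h hf]] := f_cov _ g F_pt; exists i.
have [b|r rP] := @factor_through_injection _ _ _ g h g_inj.
  have [|a a_eq] := D_clo (h b); last by exists (e' a); rewrite /= e'K.
  have [n [c bc0]] := (f_int i).2 b; exists n, (e \o c).
  rewrite -[RHS](rmorph0 h) -bc0 rmorphD rmorphXn rmorph_sum; congr (_ + _).
  by apply: eq_bigr => j _; rewrite rmorphM rmorphXn hf.
by exists r => a; apply: g_inj; rewrite rP hf.
Qed.
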